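(* Let $n\ge 1$, let $b=(b_1,\dots,b_n)$ be a sequence of positive integers, and let $k\ge 0$ be an integer. Let $\varphi:\mathbb{R}^{n+1}\to\mathbb{R}^n$ be the linear map $(a_1,\dots,a_{n+1})\mapsto(x_1,\dots,x_n)$ with $x_i=b_i(a_1+\cdots+a_i)$ for $i=1,\dots,n$. Then $\varphi$ restricts to a bijection $$\varphi:\Pi(b)_k\longrightarrow k\cdot P(b)\cap\mathbb{Z}^n$$ from the set of L-S paths of degree $k$ to the set of integral points in the $k$-dilated lecture hall polytope.
   Context: For $b=(b_1,\dots,b_n)$, let $e_1,\dots,e_{n+1}$ be the canonical basis of $\mathbb{R}^{n+1}$ and let $L(b)\subset\mathbb{R}^{n+1}$ be the lattice generated by $v_j:=\frac{e_j-e_{j+1}}{b_j}$ for $j=1,\dots,n$ and $v_{n+1}:=e_{n+1}$. The set of L-S paths with bonds $b$ is $\Pi(b):=L(b)\cap\mathbb{R}^{n+1}_{\ge 0}$. The degree of $\pi=(a_1,\dots,a_{n+1})\in\Pi(b)$ is $\deg(\pi):=a_1+\cdots+a_{n+1}$, which is a non-negative integer, and $\Pi(b)_k$ is the set of L-S paths of degree $k$. The lecture hall polytope with parameters $b$ is $P(b):=\{(x_1,\dots,x_n)\in\mathbb{R}^n : 0\le\frac{x_1}{b_1}\le\cdots\le\frac{x_n}{b_n}\le 1\}$; its dilation $k\cdot P(b)$ is given by the same inequalities with the rightmost $1$ replaced by $k$. *)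

(* Defs.v *)
From HB Require Import structures.
From mathcomp Require Import all_boot all_order all_algebra.
From mathcomp Require Import classical_sets functions reals.

Set Implicit Arguments.
Unset Strict Implicit.
Unset Printing Implicit Defensive.

Import Order.TTheory GRing.Theory Num.Theory.

Local Open Scope classical_set_scope.
Local Open Scope ring_scope.

(* Coordinates are indexed from 0: the vectors e_1, .., e_(n+1) of R^(n+1) are
   the delta_mx 0 j for j : 'I_n.+1, and b_1, .., b_n are the b i for
   i : 'I_n. *)

Definition lattice_gen (V : zmodType) (m : nat) (v : 'I_m -> V) : set V :=
  [set \sum_j v j *~ c j | c in [set: 'I_m -> int]].

Section LSPaths.
Variables (R : realType) (n : nat) (b : 'I_n -> nat).

(* For i : 'I_n, widen_ord (leqnSn n) i and lift ord0 i are i and i + 1 as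
   elements of 'I_n.+1; the index ord_max is the only one that unlift ord_max
   sends to None. *)
Definition LS_gen (j : 'I_n.+1) : 'rV[R]_n.+1 :=
  if unlift ord_max j is Some i then
    (b i)%:R^-1 *:
      (delta_mx 0 (widen_ord (leqnSn n) i) - delta_mx 0 (lift ord0 i))
  else delta_mx 0 ord_max.

Definition LS_lattice : set 'rV[R]_n.+1 := lattice_gen LS_gen.

Definition LS_paths : set 'rV[R]_n.+1 :=
  LS_lattice `&` [set a | forall j, 0 <= a 0 j].

Definition LS_deg (a : 'rV[R]_n.+1) : R := \sum_j a 0 j.

Definition LS_paths_deg (k : nat) : set 'rV[R]_n.+1 :=
  LS_paths `&` [set a | LS_deg a = k%:R].

(* The chain of inequalities 0 <= x_1 / b_1 <= ... <= x_n / b_n <= t. *)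
Definition lecture_hall_chain (t : R) (x : 'rV[R]_n) : bool :=
  sorted <=%R (0 :: rcons [seq x 0 i / (b i)%:R | i <- enum 'I_n] t).

Definition lecture_hall : set 'rV[R]_n := [set x | lecture_hall_chain 1 x].

Definition LS_phi (a : 'rV[R]_n.+1) : 'rV[R]_n :=
  \row_(i < n) ((b i)%:R * \sum_(j < n.+1 | (j <= i)%N) a 0 j).

Fact LS_phi_is_linear : linear LS_phi.
Proof.
move=> c u v; apply/rowP => i; rewrite !mxE mulrCA -mulrDr; congr (_ * _).
rewrite mulr_sumr -big_split /=.
by apply: eq_bigr => j _; rewrite !mxE.
Qed.

HB.instance Definition _ :=
  GRing.isLinear.Build R 'rV[R]_n.+1 'rV[R]_n *:%R LS_phi LS_phi_is_linear.

End LSPaths.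

Definition dilation (R : realType) (n k : nat) (P : set 'rV[R]_n) :
  set 'rV[R]_n := [set k%:R *: x | x in P].

Definition integral_points (R : realType) (n : nat) : set 'rV[R]_n :=
  [set x | forall i, x 0 i \is a Num.int].

Arguments LS_paths_deg R {n} b k _.
Arguments lecture_hall R {n} b _.
Arguments LS_phi {R n} b a.
Arguments integral_points R n _ : clear implicits.

Lemma dilation_lecture_hallE (R : realType) (n : nat) (b : 'I_n -> nat)
    (k : nat) : (forall i, (0 < b i)%N) ->
  dilation k (lecture_hall R b) = [set x | lecture_hall_chain b k%:R x].
Proof.
move=> b_gt0.
have chainZ t s (y : 'rV[R]_n) : 0 <= t -> lecture_hall_chain b s y ->
    lecture_hall_chain b (t * s) (t *: y).
  move=> t0; rewrite /lecture_hall_chain => ys.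
  have : sorted <=%R
      (map ( *%R t) (0 :: rcons [seq y 0 i / (b i)%:R | i <- enum 'I_n] s)).
    by rewrite sorted_map; apply: sub_sorted ys => u v; apply: ler_wpM2l.
  rewrite map_cons map_rcons mulr0 -map_comp.
  congr (sorted _ (_ :: rcons _ _)); apply: eq_map => i /=.
  by rewrite !mxE mulrA.
apply/seteqP; split => [_ [y /= y1 <-]|x /= xk].
  by rewrite -[X in lecture_hall_chain _ X]mulr1; apply: chainZ.
have [k0|k_neq0] := eqVneq (k%:R : R) 0; last first.
  exists (k%:R^-1 *: x); last by rewrite scalerA divff ?scale1r.
  by have := chainZ k%:R^-1 _ _ _ xk; rewrite mulVf // invr_ge0; apply.
exists 0; last first.
  rewrite scaler0; apply/esym/rowP => i; rewrite mxE.
  move: xk; rewrite k0 /lecture_hall_chain (sorted_pairwise le_trans).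
  rewrite pairwise_cons pairwise_rcons all_rcons => /and3P[/andP[_ /allP ge0]].
  move=> /allP le0 _.
  have ix : x 0 i / (b i)%:R \in [seq x 0 i / (b i)%:R | i <- enum 'I_n].
    by apply: map_f; rewrite mem_enum.
  have /eqP : x 0 i / (b i)%:R = 0 by apply/le_anti; rewrite le0 // ge0.
  by rewrite mulf_eq0 invr_eq0 pnatr_eq0 (gtn_eqF (b_gt0 i)) orbF => /eqP.
rewrite /lecture_hall /= /lecture_hall_chain.
have -> : [seq (0 : 'rV[R]_n) 0 i / (b i)%:R | i <- enum 'I_n]
    = nseq (size (enum 'I_n)) 0.
  by elim: (enum _) => //= i s ->; rewrite mxE mul0r.
by elim: (size _) => [|m /= IHm]; rewrite /= ?ler01 ?lexx.
Qed.

(* Main.v *)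
Require Import Defs.
From HB Require Import structures.
From mathcomp Require Import all_boot all_order all_algebra.
From mathcomp Require Import classical_sets functions reals.

Set Implicit Arguments.
Unset Strict Implicit.
Unset Printing Implicit Defensive.

Import Order.TTheory GRing.Theory Num.Theory.

Local Open Scope classical_set_scope.
Local Open Scope ring_scope.

(** The partial sums of [a] are 0, x_1 / b_1, .., x_n / b_n, deg a, where
    x = phi a. Hence a is recovered from (x, deg a) by taking differences, and
    its coordinates are nonnegative exactly when this sequence is nondecreasing.
    The map (phi, deg) sends the generators of L(b) to the standard basis of
    R^n x R, so a lies in L(b) exactly when x and deg a are integral. *)

Section PartialSums.
Variables (R : realType) (n : nat) (b : 'I_n -> nat).
Hypothesis b_gt0 : forall i, (0 < b i)%N.

(** This is the list tested by [lecture_hall_chain], named so that its entries can be indexed and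
    subtracted. *)
Definition chain_seq (t : R) (x : 'rV[R]_n) : seq R :=
  0 :: rcons [seq x 0 i / (b i)%:R | i <- enum 'I_n] t.

(** The candidate inverse of [a] $\mapsto$ ([LS_deg a], [LS_phi b a]). *)
Definition chain_diff (t : R) (x : 'rV[R]_n) : 'rV[R]_n.+1 :=
  \row_j ((chain_seq t x)`_j.+1 - (chain_seq t x)`_j).

Definition psum (a : 'rV[R]_n.+1) (m : nat) : R :=
  \sum_(j < n.+1 | (j < m)%N) a 0 j.

Lemma size_chain_seq t x : size (chain_seq t x) = n.+2.
Proof. by rewrite /= size_rcons size_map size_enum_ord. Qed.

Lemma nth_chain_seq t x (i : 'I_n) :
  (chain_seq t x)`_i.+1 = x 0 i / (b i)%:R.
Proof.
rewrite /= nth_rcons size_map size_enum_ord ltn_ord.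
by rewrite (nth_map i) ?size_enum_ord // nth_ord_enum.
Qed.

Lemma nth_chain_seq_last t x : (chain_seq t x)`_n.+1 = t.
Proof. by rewrite /= nth_rcons size_map size_enum_ord ltnn eqxx. Qed.

Lemma psum0 a : psum a 0 = 0.
Proof. by rewrite /psum big_pred0. Qed.

Lemma psumS a (j : 'I_n.+1) : psum a j.+1 = psum a j + a 0 j.
Proof.
rewrite /psum (bigD1 j) //= addrC; congr (_ + _); apply: eq_bigl => i.
by rewrite ltnS [RHS]ltn_neqAle andbC.
Qed.

Lemma psum_last a : psum a n.+1 = LS_deg a.
Proof. by apply: eq_bigl => j; rewrite ltn_ord. Qed.

Lemma LS_phiE a i : LS_phi b a 0 i = (b i)%:R * psum a i.+1.
Proof. by rewrite mxE. Qed.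

Lemma psum_chain_seq a m : (m <= n.+1)%N ->
  psum a m = (chain_seq (LS_deg a) (LS_phi b a))`_m.
Proof.
case: m => [|m]; first by rewrite psum0.
rewrite ltnS leq_eqVlt => /predU1P[->|mn].
  by rewrite psum_last nth_chain_seq_last.
rewrite (nth_chain_seq _ _ (Ordinal mn)) LS_phiE mulrAC divff ?mul1r //.
by rewrite pnatr_eq0 -lt0n.
Qed.

Lemma LS_phiK a : chain_diff (LS_deg a) (LS_phi b a) = a.
Proof.
apply/rowP => j; rewrite mxE -!psum_chain_seq //; last exact: ltnW.
by rewrite psumS addrC addKr.
Qed.

(** The sum telescopes, and the list starts with 0, so no constant is left over. *)
Lemma psum_chain_diff t x m : (m <= n.+1)%N ->
  psum (chain_diff t x) m = (chain_seq t x)`_m.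
Proof.
elim: m => [|m IHm mn]; first by rewrite psum0.
by rewrite (psumS _ (Ordinal mn)) IHm 1?ltnW // mxE addrC subrK.
Qed.

Lemma LS_phi_chain_diff t x : LS_phi b (chain_diff t x) = x.
Proof.
apply/rowP => i; rewrite LS_phiE psum_chain_diff 1?ltnW ?ltnS //.
by rewrite nth_chain_seq mulrC divfK // pnatr_eq0 -lt0n.
Qed.

Lemma LS_deg_chain_diff t x : LS_deg (chain_diff t x) = t.
Proof. by rewrite -psum_last psum_chain_diff // nth_chain_seq_last. Qed.

(** Sortedness only compares neighbours, and the coordinates of [chain_diff] are exactly the gaps
    between neighbours. *)
Lemma chain_diff_ge0 t x :
  (forall j, 0 <= chain_diff t x 0 j) <-> lecture_hall_chain b t x.
Proof.
rewrite /lecture_hall_chain -/(chain_seq t x); split => [d0|/(sortedP 0) d0 j].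
  apply/(sortedP 0) => m; rewrite size_chain_seq !ltnS => mn.
  by have := d0 (Ordinal (mn : m < n.+1)%N); rewrite mxE subr_ge0.
by rewrite mxE subr_ge0 d0 // size_chain_seq ltnS.
Qed.

Lemma sum_delta_row (P : pred 'I_n.+1) (l : 'I_n.+1) :
  \sum_(j | P j) (delta_mx 0 l : 'rV[R]_n.+1) 0 j = (P l)%:R.
Proof.
under eq_bigr do rewrite mxE eqxx /=.
by rewrite -natr_sum big_mkcond (bigD1 l) //= eqxx big1 ?addn0 => [|j /negPf->];
   case: (P _).
Qed.

(** The codomain is read as [R^o], the ring as a module over itself, so that the generic lemmas on
    linear maps apply to the degree. *)
Lemma LS_deg_is_linear : linear (@LS_deg R n : _ -> R^o).
Proof.
move=> c u v; rewrite /LS_deg scaler_sumr -big_split /=.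
by apply: eq_bigr => j _; rewrite !mxE.
Qed.

HB.instance Definition _ :=
  GRing.isLinear.Build R 'rV[R]_n.+1 R^o *:%R (@LS_deg R n) LS_deg_is_linear.

Lemma LS_deg_delta l : LS_deg (delta_mx 0 l : 'rV[R]_n.+1) = 1.
Proof. exact: (sum_delta_row predT). Qed.

Lemma LS_gen_lift i : LS_gen R b (lift ord_max i) = (b i)%:R^-1 *:
  (delta_mx 0 (widen_ord (leqnSn n) i) - delta_mx 0 (lift ord0 i)).
Proof. by rewrite /LS_gen liftK. Qed.

Lemma LS_gen_max : LS_gen R b ord_max = delta_mx 0 ord_max.
Proof. by rewrite /LS_gen unlift_none. Qed.

Lemma LS_deg_gen_lift i : LS_deg (LS_gen R b (lift ord_max i)) = 0.
Proof. by rewrite LS_gen_lift linearZ linearB /= !LS_deg_delta subrr scaler0. Qed.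

Lemma LS_phi_delta l i :
  LS_phi b (delta_mx 0 l : 'rV[R]_n.+1) 0 i = (b i)%:R * (l <= i)%:R.
Proof. by rewrite LS_phiE /psum sum_delta_row. Qed.

Lemma LS_phi_gen_lift i : LS_phi b (LS_gen R b (lift ord_max i)) = delta_mx 0 i.
Proof.
apply/rowP => m; rewrite LS_gen_lift linearZ linearB /=.
rewrite mxE [X in _ * X]mxE [X in _ + X]mxE !LS_phi_delta [RHS]mxE eqxx /=.
rewrite -mulrBr /bump /= add1n -val_eqE /=.
(* The indicators of [i <= m] and [i < m] are both 0 for [m < i] and both 1 for [i < m]. They differ
   only at [m = i], where [b i] cancels its inverse. *)
have [mi|im|/val_inj->] := ltngtP m i; rewrite ?subrr ?mulr0 //.
by rewrite subr0 mulr1 mulVf // pnatr_eq0 -lt0n.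
Qed.

(** The last coordinate enters only the full sum, which is the degree and not a component of
    [LS_phi]. *)
Lemma LS_phi_gen_max : LS_phi b (LS_gen R b ord_max) = 0.
Proof.
by apply/rowP => i; rewrite LS_gen_max LS_phi_delta mxE leqNgt ltn_ord mulr0.
Qed.

Definition LS_comb (c : 'I_n.+1 -> int) : 'rV[R]_n.+1 :=
  \sum_j LS_gen R b j *~ c j.

Lemma LS_deg_comb c : LS_deg (LS_comb c) = (c ord_max)%:~R.
Proof.
rewrite /LS_comb linear_sum (bigD1_ord ord_max) //= big1 ?addr0 => [|i _].
  by rewrite raddfMz /= LS_gen_max LS_deg_delta.
by rewrite raddfMz /= LS_deg_gen_lift mul0rz.
Qed.

Lemma LS_phi_comb c : LS_phi b (LS_comb c) = \row_i (c (lift ord_max i))%:~R.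
Proof.
rewrite /LS_comb linear_sum (bigD1_ord ord_max) //= raddfMz /= LS_phi_gen_max.
rewrite mul0rz add0r [RHS]row_sum_delta; apply: eq_bigr => i _.
by rewrite raddfMz /= LS_phi_gen_lift mxE scaler_int.
Qed.

Lemma LS_latticeP a :
  LS_lattice b a <-> integral_points R n (LS_phi b a) /\ LS_deg a \is a Num.int.
Proof.
split=> [[c _ <-]|[x_int /intrP[d deg_a]]].
  rewrite -/(LS_comb c) LS_deg_comb LS_phi_comb; split=> [i|]; last exact: intr_int.
  by rewrite mxE intr_int.
(* The coefficients are forced by [LS_phi_comb] and [LS_deg_comb]. The floor merely turns the
   integral real $x_i$ into an [int], and [floorK] makes it exact. By [LS_phiK], comparing images
   and degrees then suffices. *)
pose c j := if unlift ord_max j is Some i then Num.floor (LS_phi b a 0 i) else d.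
exists c => //; rewrite -/(LS_comb c) -[LHS]LS_phiK -[RHS]LS_phiK.
rewrite LS_deg_comb LS_phi_comb deg_a {1}/c unlift_none; congr chain_diff.
by apply/rowP => i; rewrite mxE /c liftK floorK.
Qed.

End PartialSums.

Theorem proposition2p5 (R : realType) (n : nat) (b : 'I_n -> nat) (k : nat)
    (n_ge1 : (1 <= n)%N) (b_gt0 : forall i, (0 < b i)%N) :
  set_bij (LS_paths_deg R b k)
    (dilation k (lecture_hall R b) `&` integral_points R n)
    (LS_phi b).
Proof.
rewrite dilation_lecture_hallE //; split.
- move=> a [[/(LS_latticeP b_gt0)[x_int _] a_ge0] /= deg_a]; split=> //=.
  (* With [k] equal to the degree of [a], the differences are the coordinates of [a] itself. *)
  by apply/chain_diff_ge0 => j; rewrite -deg_a LS_phiK.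
- move=> a a' /set_mem[_ /= deg_a] /set_mem[_ /= deg_a'] eq_phi.
  (* Injectivity needs the common degree [k]: [LS_phi] alone forgets the last coordinate. *)
  by rewrite -(LS_phiK b_gt0 a) -(LS_phiK b_gt0 a') eq_phi deg_a deg_a'.
- move=> x [/= /chain_diff_ge0 d_ge0 x_int].
  exists (chain_diff b k%:R x); last exact: LS_phi_chain_diff.
  split; last exact: LS_deg_chain_diff.
  split=> //; apply/LS_latticeP => //.
  by rewrite LS_phi_chain_diff // LS_deg_chain_diff natr_int.
Qed.
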